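(* Let $K\subset\mathbb{R}$ be a self-similar set satisfying the open set condition (OSC). Then $s_0(K)<\dim_M K$ if and only if $K$ is locally flat. In this case, $\dim_M K=1$.
   Context: **Self-similar sets.** Let $N\ge 2$ and let $S_1,\dots,S_N:\mathbb{R}\to\mathbb{R}$ be contracting similarities with ratios $r_i\in(0,1)$. The self-similar set generated by $\{S_1,\dots,S_N\}$ is the unique nonempty compact set $K$ with $K=\bigcup_i S_iK$. It satisfies OSC if there is a nonempty open set $O$ with $\bigcup_i S_iO\subset O$ and $S_iO\cap S_jO=\emptyset$ for $i\ne j$. $\dim_M$ denotes Minkowski (box) dimension (it exists for such $K$). **Local flatness in $\mathbb{R}$.** $K\subset\mathbb{R}$ is locally flat (equivalently locally $1$-flat) if for every $x\in K$ and $\varepsilon>0$ there is a nondegenerate closed interval $C\subset[x-\varepsilon,x+\varepsilon]$ such that $C^\circ\cap K\ne\emptyset$ and $C\cap K$ is similar to $[0,1]$. **Scaling exponent.** For bounded $F\subset\mathbb{R}$ let $F_\varepsilon=\{y\in\mathbb{R}:\mathrm{dist}(y,F)\le\varepsilon\}$ and $C_0^{\mathrm{var}}(F_\varepsilon)=\tfrac12\mathcal H^{0}(\partial F_\varepsilon)$ (half the number of boundary points). Then $s_{0}(F):=\inf\{s\ge0:\ \mathrm{ess\,lim}_{\varepsilon\to0}\,\varepsilon^{s}C_{0}^{\mathrm{var}}(F_\varepsilon)=0\}$, where the essential limit means the limit after discarding a Lebesgue null set of $\varepsilon$'s. *)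

(* Defs.v *)
From mathcomp Require Import all_boot all_order all_algebra.
From mathcomp Require Import all_classical all_reals all_analysis.
Import Order.TTheory GRing.Theory Num.Theory.
Import numFieldNormedType.Exports.

Set Implicit Arguments.
Unset Strict Implicit.
Unset Printing Implicit Defensive.

Local Open Scope classical_set_scope.
Local Open Scope ring_scope.

(* No positivity is built into the ratio [c]: it is imposed where needed. *)
Definition similarity (R : realType) (c : R) (f : R -> R) : Prop :=
  forall x y, `|f x - f y| = c * `|x - y|.

Definition similar_sets (R : realType) (A B : set R) : Prop :=
  exists c f, [/\ 0 < c, similarity c f & f @` A = B].

Definition self_similar_set (R : realType) (N : nat) (S : 'I_N -> R -> R)
    (K : set R) : Prop :=
  [/\ K !=set0, compact K & K = \bigcup_(i in [set: 'I_N]) (S i @` K)].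

Definition open_set_condition (R : realType) (N : nat)
    (S : 'I_N -> R -> R) : Prop :=
  exists O : set R,
    [/\ open O, O !=set0,
        \bigcup_(i in [set: 'I_N]) (S i @` O) `<=` O &
        forall i j, i != j -> (S i @` O) `&` (S j @` O) = set0].

Definition locally_flat (R : realType) (K : set R) : Prop :=
  forall x, K x -> forall e : R, 0 < e -> exists a b : R,
    let C := `[a, b]%classic in
    [/\ a < b, C `<=` `[x - e, x + e]%classic, interior C `&` K !=set0 &
        similar_sets (C `&` K) `[0, 1]%classic].

Definition parallel_set (R : realType) (F : set R) (e : R) : set R :=
  [set y | (edist_inf F y <= e%:E)%E].

Definition frontier (R : realType) (A : set R) : set R := closure A `\` interior A.

(* The zero-dimensional Hausdorff measure is the counting measure. *)
Definition C0var (R : realType) (A : set R) : \bar R :=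
  ((2^-1)%:E * counting (frontier A))%E.

Definition ess_cvg0 (R : realType) (g : R -> \bar R) (l : \bar R) : Prop :=
  exists Z : set R, (@lebesgue_measure R).-negligible Z /\
    g e @[e --> within (~` Z) (0 : R)^'+] --> l.

(* The infimum is taken in \bar R, so that it is +oo on the empty set. *)
Definition scaling_exponent0 (R : realType) (F : set R) : \bar R :=
  ereal_inf [set s%:E | s in [set s : R | 0 <= s /\
    ess_cvg0 (fun e => ((e `^ s)%:E * C0var (parallel_set F e))%E) 0%E]].

(* Minkowski dimension in ambient dimension 1, through the volume of the
   parallel sets; the value is meaningful when the limit exists, which is the
   case for self-similar sets. *)
Definition minkowski_dim (R : realType) (F : set R) : R :=
  1 - lim (ln (fine (lebesgue_measure (parallel_set F e))) / ln e
             @[e --> (0 : R)^'+]).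

(* Main.v *)
(* Comparing the Lebesgue measures of a bounded feasible open set [U] and of its
   images gives [\sum_i r i <= 1], with equality only if [U] lies in [K].  So the
   dichotomy is between [K] with interior and [\sum_i r i < 1].

   If [K] has interior, some small copy [g j0 K] lies in the interior of [K], so
   no frontier point of the [e]-parallel set comes from that copy, and the number
   [F e] of frontier points satisfies [F e <= \sum_(j != j0) F (e / sg j)].
   As [\sum_(j != j0) sg j < 1], this forces [F e = O(e^-t)] for some [t < 1],
   while the Minkowski dimension is 1.

   If [\sum_i r i < 1], let [\sum_i r i ^ D = 1] and let [V e] be the measure of
   the [e]-parallel set.  Comparing [V e] with [\sum_i r i * V (e / r i)], and
   likewise for the part of the parallel set inside [U], where the pieces are
   disjoint, gives [c e^(1-D) <= V e <= C e^(1-D)].  On the other hand each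
   frontier point contributes at most [2 (h - e)] to [V h - V e], so that a bound
   [F e = O(e^-s)] with [s < D] for almost every [e] would give
   [V h = O(h^(1-s))], which is impossible. *)
Require Import Defs.
From mathcomp Require Import all_boot all_order all_algebra.
From mathcomp Require Import all_classical all_reals all_analysis.
From mathcomp Require Import measurable_realfun.
From mathcomp Require Import ring lra.
Import Order.TTheory GRing.Theory Num.Theory.
Import numFieldNormedType.Exports.

Set Implicit Arguments.
Unset Strict Implicit.
Unset Printing Implicit Defensive.

Local Open Scope classical_set_scope.
Local Open Scope ring_scope.

(** * Similarities of the line *)

Lemma measurable_affine (R : realType) (a b : R) :
  measurable_fun [set: measurableTypeR R]
    (fun x : measurableTypeR R => a * x + b : measurableTypeR R).
Proof.
apply: continuous_measurable_fun => x.
by apply: cvgD; [apply: cvgM; [exact: cvg_cst|exact: cvg_id]|exact: cvg_cst].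
Qed.

(** The push-forward of Lebesgue measure under the affine map, scaled by [|a|], agrees with Lebesgue
    measure on half-open intervals, and these determine it. The sign of [a] decides which end of the
    interval stays closed. *)
Lemma lebesgue_measure_affine_preimage (R : realType) (a b : R) (A : set R) :
  a != 0 -> measurable A ->
  lebesgue_measure A =
  (`|a|%:E * lebesgue_measure ((fun x => a * x + b)%R @^-1` A))%E.
Proof.
move=> a0 mA.
pose pf := measure_function_pushforward__canonical__measure_function_Measure
  (@lebesgue_measure R) (measurable_affine a b).
pose mu := mscale (NngNum (normr_ge0 a)) pf.
rewrite (@lebesgue_measure_unique R mu)// => _ [[u v] _ <-] /=.
rewrite /mu /mscale /= /pushforward.
have [a_gt0|a_le0] := ltP 0 a.
  have -> : (fun x : measurableTypeR R => a * x + b) @^-1` `]u, v] =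
      `](u - b) / a, (v - b) / a]%classic.
    apply/seteqP; split=> x /=;
      rewrite !in_itv/= ltr_pdivrMr// ler_pdivlMr// => /andP[? ?];
      apply/andP; split; lra.
  rewrite !lebesgue_measure_itv/= !lte_fin ltr_pM2r ?invr_gt0// ltrD2r.
  case: ifPn => _; last by rewrite mule0.
  by rewrite -!EFinB -EFinM gtr0_norm//; congr EFin; field.
have a_lt0 : a < 0 by rewrite lt_neqAle a0.
have -> : (fun x : measurableTypeR R => a * x + b) @^-1` `]u, v] =
    `[(v - b) / a, (u - b) / a[%classic.
  apply/seteqP; split=> x /=;
    rewrite !in_itv/= ler_ndivrMr// ltr_ndivlMr// => /andP[? ?];
    apply/andP; split; lra.
rewrite !lebesgue_measure_itv/= !lte_fin ltr_nM2r ?invr_lt0// ltrD2r.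
case: ifPn => _; last by rewrite mule0.
by rewrite -!EFinB -EFinM ltr0_norm//; congr EFin; field.
Qed.

Lemma similarity_affine (R : realType) (c : R) (f : R -> R) :
  0 < c -> similarity c f ->
  exists2 a : R, `|a| = c & exists b, forall x, f x = a * x + b.
Proof.
move=> c0 hf; exists (f 1 - f 0); first by rewrite hf subr0 normr1 mulr1.
exists (f 0) => x.
have sq y z : (f y - f z) ^+ 2 = c ^+ 2 * (y - z) ^+ 2.
  by rewrite -real_normK ?num_real// hf exprMn real_normK ?num_real.
(* The squared distances of [f x] to [f 0] and to [f 1] differ by an expression linear in [f x],
   which determines [f x]. *)
have a2 := sq 1 0; have u2 := sq x 0; have v2 := sq x 1.
have a0 : f 1 - f 0 != 0.
  by rewrite -normr_eq0 hf subr0 normr1 mulr1 gt_eqF.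
move: a2; rewrite subr0 expr1n mulr1 => a2.
by apply: (mulfI a0); move: u2 v2; rewrite -a2; lra.
Qed.

Lemma similarity_surj (R : realType) (c : R) (f : R -> R) :
  0 < c -> similarity c f -> forall y, exists x, f x = y.
Proof.
move=> c0 hf y; have [a ac [b fE]] := similarity_affine c0 hf.
have a0 : a != 0 by rewrite -normr_eq0 ac gt_eqF.
by exists ((y - b) / a); rewrite fE; field.
Qed.

Lemma similarity_inj (R : realType) (c : R) (f : R -> R) :
  0 < c -> similarity c f -> injective f.
Proof.
move=> c0 hf x y fxy; apply/eqP; rewrite -subr_eq0 -normr_eq0.
by have := hf x y; rewrite fxy subrr normr0 => /esym/eqP; rewrite mulf_eq0 gt_eqF.
Qed.

Lemma similarity_measure (R : realType) (c : R) (f : R -> R) (A : set R) :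
  0 < c -> similarity c f -> measurable A ->
  measurable (f @` A) /\
  (lebesgue_measure (f @` A) = c%:E * lebesgue_measure A)%E.
Proof.
move=> c0 hf mA; have [a ac [b fE]] := similarity_affine c0 hf.
have a0 : a != 0 by rewrite -normr_eq0 ac gt_eqF.
have fAE : f @` A = (fun x => a^-1 * x + - (a^-1 * b)) @^-1` A.
  apply/seteqP; split=> [_ [x Ax <-]|y /= Ay].
    by rewrite /= fE (_ : _ + _ = x)//; field.
  by exists (a^-1 * y - a^-1 * b) => //; rewrite fE; field.
split; first by rewrite fAE -[X in measurable X]setTI; exact: measurable_affine.
rewrite (@lebesgue_measure_affine_preimage R a^-1 (- (a^-1 * b)) A)// ?invr_eq0//.
by rewrite -fAE muleA -EFinM -ac -normrM divff// normr1 mul1e.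
Qed.

(** * Parallel sets *)

Lemma lebesgue_measure_le (R : realType) (A B : set R) :
  measurable A -> measurable B -> A `<=` B ->
  (lebesgue_measure A <= lebesgue_measure B)%E.
Proof. by move=> mA mB AB; apply: le_measure; rewrite ?inE. Qed.

Lemma interior_dist (R : realType) (A : set R) (x : R) :
  interior A x <-> exists2 d : R, 0 < d & forall y, `|x - y| < d -> A y.
Proof.
split=> [/nbhs_ballP[d /= d0 dA]|[d d0 dA]].
  by exists d => // y xy; apply: dA; rewrite -ball_normE.
by apply/nbhs_ballP; exists d => //= y; rewrite -ball_normE => /dA.
Qed.

Lemma edist_le (R : realType) (x y d : R) :
  0 <= d -> (edist (x, y) <= d%:E)%E = (`|x - y| <= d).
Proof.
move=> d0; apply/idP/idP => h.
  apply/ler_addgt0Pr => u u0; apply/ltW.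
  have := @edist_lt_ball R R (d + u) (x, y); rewrite -ball_normE; apply.
  by rewrite (le_lt_trans h)// lte_fin ltrDl.
apply/lee_addgt0Pr => u u0; rewrite -EFinD.
apply: edist_fin => /=; first by rewrite ltr_wpDl.
by rewrite -ball_normE /= (le_lt_trans h)// ltrDl.
Qed.

(** Compactness makes the infimum defining the distance attained, so the non-strict bound is
    realised by a point of [K]. *)
Lemma parallel_setP (R : realType) (K : set R) (e y : R) :
  compact K -> 0 <= e ->
  parallel_set K e y <-> exists2 k, K k & `|y - k| <= e.
Proof.
move=> cK e0; rewrite /parallel_set /=; split=> [h|[k Kk yk]]; last first.
  rewrite (@le_trans _ _ (edist (y, k)))// ?edist_le//.
  by apply: ereal_inf_lbound; exists k.
have [K0|/set0P K0] := eqVneq K set0.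
  by move: h; rewrite /edist_inf K0 image_set0 ereal_inf0 leye_eq.
have [|k /set_mem Kk kmin] := @compact_EVT_min R R (fun k => `|y - k|) K K0 cK.
  apply: continuous_subspaceT => x; apply: cvg_norm.
  by apply: cvgB; [exact: cvg_cst|exact: cvg_id].
exists k => //; rewrite leNgt; apply/negP => ek.
have : (edist_inf K y < `|y - k|%:E)%E by rewrite (le_lt_trans h).
move=> /ereal_inf_lt[_ [k' Kk' <-]] /edist_lt_ball; rewrite -ball_normE /=.
by rewrite ltNge kmin// inE.
Qed.

Lemma closed_parallel_set (R : realType) (K : set R) (e : R) :
  closed (parallel_set K e).
Proof.
apply: (@closed_comp _ _ (edist_inf K) [set x | (x <= e%:E)%E]).
  by move=> x _; exact: edist_inf_continuous.
exact: closed_ereal_ge_ereal.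
Qed.

Lemma measurable_parallel_set (R : realType) (K : set R) (e : R) :
  measurable (parallel_set K e).
Proof. by apply: closed_measurable; exact: closed_parallel_set. Qed.

Lemma parallel_set_le (R : realType) (K : set R) (e1 e2 : R) :
  e1 <= e2 -> parallel_set K e1 `<=` parallel_set K e2.
Proof. by move=> e12 y /le_trans; apply; rewrite lee_fin. Qed.

Lemma frontier_parallel_setE (R : realType) (K : set R) (e : R) :
  frontier (parallel_set K e) = parallel_set K e `\` interior (parallel_set K e).
Proof.
by rewrite /frontier -(closure_id (parallel_set K e)).1//; exact: closed_parallel_set.
Qed.

(** * Contraction ratios and induction over scales *)

Lemma exprn_small (R : realType) (rho M d : R) :
  0 < rho < 1 -> 0 < d -> exists n, rho ^+ n * M < d.
Proof.
move=> /andP[r0 r1] d0.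
have h : rho ^+ n * M @[n --> \oo] --> (0 : R).
  rewrite -[X in _ --> X](mul0r M); apply: cvgM; last exact: cvg_cst.
  by apply: cvg_expr; rewrite gtr0_norm.
have [n _ /(_ n (leqnn _))] : \forall n \near \oo, rho ^+ n * M < d.
  by apply: (cvgr_lt 0).
by exists n.
Qed.

Lemma ratio_upper_bound (R : realType) (J : finType) (sg : J -> R) :
  (forall j, 0 < sg j < 1) -> exists2 rho : R, 0 < rho < 1 & forall j, sg j <= rho.
Proof.
(* The default [2^-1] keeps the bound strictly between 0 and 1 even when [J] is empty. *)
move=> h; exists (\big[Num.max/2^-1]_j sg j) => [|j]; last exact: le_bigmax.
elim/big_ind: _ => [|x y /andP[x0 x1] /andP[y0 y1]|j _]; last exact: h.
- by rewrite invr_gt0 ltr0n invf_lt1 ?ltr0n ?ltr1n.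
- by rewrite lt_max x0 gt_max x1.
Qed.

Lemma ratio_lower_bound (R : realType) (J : finType) (sg : J -> R) :
  (forall j, 0 < sg j < 1) -> exists2 tau : R, 0 < tau < 1 & forall j, tau <= sg j.
Proof.
move=> h; exists (\big[Num.min/2^-1]_j sg j) => [|j]; last exact: bigmin_le.
elim/big_ind: _ => [|x y /andP[x0 x1] /andP[y0 y1]|j _]; last exact: h.
- by rewrite invr_gt0 ltr0n invf_lt1 ?ltr0n ?ltr1n.
- by rewrite gt_min x1 lt_min x0 y0.
Qed.

(* Every small scale is brought into the window [e0, e1] by dividing repeatedly
   by ratios, which never jump over it since e0 <= sg j * e1. *)
Lemma scale_induction (R : realType) (J : finType) (sg : J -> R) (P : R -> Prop)
    (e0 e1 : R) :
  (forall j, 0 < sg j < 1) -> 0 < e0 -> (forall j, e0 <= sg j * e1) ->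
  (forall e, e0 <= e <= e1 -> P e) ->
  (forall e, 0 < e < e0 -> (forall j, P (e / sg j)) -> P e) ->
  forall e, 0 < e <= e1 -> P e.
Proof.
move=> hsg e0_gt0 he base step.
have [rho /andP[r0 r1] hrho] := ratio_upper_bound hsg.
(* Dividing by [sg j <= rho] lifts a scale above [rho ^+ n.+1 * e0] to one above [rho ^+ n * e0], so
   [n] bounds the number of divisions needed. *)
have H n : forall e, rho ^+ n * e0 <= e <= e1 -> P e.
  elim: n => [|n IH] e /andP[ne e1e].
    by apply: base; rewrite e1e -[e0]mul1r -(expr0 rho) ne.
  have [ee0|ee0] := leP e0 e; first by apply: base; rewrite ee0.
  have e_gt0 : 0 < e by rewrite (lt_le_trans _ ne)// mulr_gt0// exprn_gt0.
  apply: step => [|j]; first by rewrite e_gt0.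
  have /andP[sj0 sj1] := hsg j; apply: IH; apply/andP; split.
    rewrite ler_pdivlMr// (le_trans _ ne)// exprSr -!mulrA.
    by rewrite ler_pM2l ?exprn_gt0// mulrC ler_pM2r.
  by rewrite ler_pdivrMr// mulrC (le_trans (ltW ee0)).
move=> e /andP[e_gt0 ee1].
have [|n hn] := @exprn_small R rho e0 e _ e_gt0; first by rewrite r0.
by apply: (H n); rewrite ltW.
Qed.

(** * Attractors and their refinements *)

(** The index is an arbitrary finite type, so that pairs of indices again index a system when maps
    are composed. *)
Definition attractor (R : realType) (J : finType) (g : J -> R -> R)
    (sg : J -> R) (K : set R) : Prop :=
  [/\ K !=set0 /\ compact K, forall j, 0 < sg j < 1,
      forall j, similarity (sg j) (g j) & K = \bigcup_(j in [set: J]) (g j @` K)].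

Lemma attractor_iter (R : realType) (J : finType) (g : J -> R -> R)
    (sg : J -> R) (K : set R) (rho : R) (n : nat) :
  attractor g sg K -> \sum_j sg j <= 1 -> (forall j, sg j <= rho) ->
  exists (J' : finType) (g' : J' -> R -> R) (sg' : J' -> R),
    [/\ attractor g' sg' K, \sum_j sg' j <= 1 & forall j, sg' j <= rho ^+ n].
Proof.
move=> [K0 sg01 gsim gK] sum1 sgrho.
elim: n => [|n [J' [g' [sg' [[_ sg01' gsim' gK'] sum1' sgrho']]]]].
  exists J, g, sg; split=> // j; rewrite expr0; have := sg01 j; lra.
(* Composing with one more map multiplies the ratios, and the sum of the products is the product of
   the sums. *)
exists (J * J')%type, (fun p => g p.1 \o g' p.2), (fun p => sg p.1 * sg' p.2).
split; first split=> //.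
- move=> [i j] /=; have /andP[i0 i1] := sg01 i; have /andP[j0 j1] := sg01' j.
  by rewrite mulr_gt0//= mulr_ilt1// ltW.
- by move=> [i j] x y /=; rewrite gsim gsim' mulrA.
- apply/seteqP; split=> x.
    rewrite {1}gK => -[i _ [y]]; rewrite {1}gK' => -[j _ [z Kz <-]] <-.
    by exists (i, j) => //; exists z.
  move=> [[i j] _ [z Kz <-]]; rewrite gK; exists i => //; exists (g' j z) => //.
  by rewrite gK'; exists j => //; exists z.
- rewrite -(pair_bigA _ (fun i j => sg i * sg' j))/=.
  rewrite (eq_bigr (fun i => sg i * \sum_j sg' j)); last first.
    by move=> i _; rewrite mulr_sumr.
  rewrite -mulr_suml mulr_ile1//; apply: sumr_ge0 => j _.
    by have /andP[/ltW] := sg01 j.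
  by have /andP[/ltW] := sg01' j.
- move=> [i j] /=; rewrite exprS ler_pM//.
    by have /andP[/ltW] := sg01 i.
  by have /andP[/ltW] := sg01' j.
Qed.

Lemma compact_dist_bound (R : realType) (K : set R) :
  compact K -> exists2 M : R, 0 < M & forall x y, K x -> K y -> `|x - y| <= M.
Proof.
move=> /compact_bounded[M [_ hM]]; exists (`|M| + 1 + (`|M| + 1)) => [|x y Kx Ky].
  by rewrite addr_gt0// ltr_wpDl.
have lM : M < `|M| + 1 by rewrite ltr_pwDr// ler_norm.
by rewrite (le_trans (ler_normB _ _))// lerD// hM.
Qed.

(** The pieces of a refinement have diameter at most [rho ^+ n * M]; once this is below [d], a piece
    containing [x] serves as [j0]. *)
Lemma attractor_zoom (R : realType) (J : finType) (g : J -> R -> R)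
    (sg : J -> R) (K : set R) (x d : R) :
  attractor g sg K -> \sum_j sg j <= 1 -> K x -> 0 < d ->
  exists (J' : finType) (g' : J' -> R -> R) (sg' : J' -> R) (j0 : J'),
    [/\ attractor g' sg' K, \sum_j sg' j <= 1 &
        forall k, K k -> `|x - g' j0 k| < d].
Proof.
move=> gK sum1 Kx d0; have [[_ cK] sg01 _ _] := gK.
have [rho rho01 hrho] := ratio_upper_bound sg01.
have [M M0 hM] := compact_dist_bound cK.
have [n hn] := exprn_small M rho01 d0.
have [J' [g' [sg' [gK' sum1' hsg']]]] := attractor_iter n gK sum1 hrho.
have [_ sg01' gsim' KE] := gK'.
have [j0 _ [k0 Kk0 xE]] : (\bigcup_(j in [set: J']) (g' j @` K)) x by rewrite -KE.
exists J', g', sg', j0; split=> // k Kk.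
rewrite -xE gsim' (le_lt_trans _ hn)// ler_pM// ?hM//.
by have /andP[/ltW] := sg01' j0.
Qed.

Lemma attractor_sub (R : realType) (J : finType) (g : J -> R -> R)
    (sg : J -> R) (K : set R) (j : J) (k : R) :
  attractor g sg K -> K k -> K (g j k).
Proof. by move=> [_ _ _ KE] Kk; rewrite KE; exists j => //; exists k. Qed.

Lemma parallel_set_piece (R : realType) (J : finType) (g : J -> R -> R)
    (sg : J -> R) (K : set R) (e : R) (j : J) :
  attractor g sg K -> 0 < e ->
  g j @` parallel_set K (e / sg j) `<=` parallel_set K e.
Proof.
move=> gK e0 _ [x + <-]; have [[_ cK] sg01 gsim _] := gK.
have /andP[sj0 _] := sg01 j.
rewrite !parallel_setP ?divr_ge0 ?ltW// => -[k Kk xk].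
exists (g j k); first exact: attractor_sub gK Kk.
by rewrite gsim mulrC -ler_pdivlMr.
Qed.

(** A point of [K] close to [y] lies in some piece [j], and pulling back by [g j] divides distances
    by [sg j]. The nearby point of the piece is recorded as well, since it later excludes [j0] at
    frontier points. *)
Lemma parallel_set_cover (R : realType) (J : finType) (g : J -> R -> R)
    (sg : J -> R) (K : set R) (e y : R) :
  attractor g sg K -> 0 < e -> parallel_set K e y ->
  exists j, (exists2 k, K k & `|y - g j k| <= e) /\
            exists2 x, parallel_set K (e / sg j) x & g j x = y.
Proof.
move=> gK e0; have [[_ cK] sg01 gsim KE] := gK.
rewrite parallel_setP ?ltW// => -[k' + yk']; rewrite {1}KE => -[j _ [k Kk kE]].
have /andP[sj0 _] := sg01 j.
exists j; split; first by exists k => //; rewrite kE.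
have [x xE] := similarity_surj sj0 (gsim j) y.
exists x => //; rewrite parallel_setP ?divr_ge0 ?ltW//; exists k => //.
by rewrite ler_pdivlMr// mulrC -gsim xE kE.
Qed.

(** A ball about [k] inside [K], translated by [y - k], stays in the parallel set because each point
    moves by at most [e]. *)
Lemma interior_parallel_set (R : realType) (K : set R) (e k y : R) :
  compact K -> 0 <= e -> interior K k -> `|y - k| <= e ->
  interior (parallel_set K e) y.
Proof.
move=> cK e0 /interior_dist[d d0 hd] yk; apply/interior_dist; exists d => // z yz.
rewrite parallel_setP//; exists (k + (z - y)).
  by apply: hd; rewrite opprD addNKr normrN distrC.
by rewrite (_ : z - (k + (z - y)) = y - k)//; ring.
Qed.

Lemma similarity_interior (R : realType) (c : R) (f : R -> R) (A : set R) (x : R) :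
  0 < c -> similarity c f -> interior A x -> interior (f @` A) (f x).
Proof.
move=> c0 hf /interior_dist[d d0 hd]; apply/interior_dist.
exists (c * d) => [|y]; first exact: mulr_gt0.
have [z <-] := similarity_surj c0 hf y.
by rewrite hf ltr_pM2l// => xz; exists z => //; exact: hd.
Qed.

(** Points within [e] of the piece [j0] are interior, as that piece lies in the interior of [K]. For
    the other pieces, an interior preimage would have an interior image. *)
Lemma frontier_parallel_cover (R : realType) (J : finType) (g : J -> R -> R)
    (sg : J -> R) (K : set R) (e y : R) (j0 : J) :
  attractor g sg K -> 0 < e -> (forall k, K k -> interior K (g j0 k)) ->
  frontier (parallel_set K e) y ->
  exists2 j, j != j0 &
    exists2 x, frontier (parallel_set K (e / sg j)) x & g j x = y.
Proof.
move=> gK e0 Kj0; rewrite frontier_parallel_setE => -[ye yNint].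
have [[_ cK] sg01 gsim KE] := gK.
have [j [[k Kk yk] [x xe xE]]] := parallel_set_cover gK e0 ye.
exists j.
  apply/eqP => jj0; apply: yNint; apply: (@interior_parallel_set _ _ _ (g j k)) => //.
    exact: ltW.
  by rewrite jj0; exact: Kj0.
exists x => //; rewrite frontier_parallel_setE; split=> // xint; apply: yNint.
have /andP[sj0 _] := sg01 j.
apply: (interiorS (parallel_set_piece (j := j) gK e0)).
by rewrite -xE; exact: similarity_interior (gsim j) xint.
Qed.

Lemma measure_bigcup_le (R : realType) (J : finType) (F : J -> set R) (A : set R) :
  (forall j, measurable (F j)) -> measurable A ->
  A `<=` \bigcup_(j in [set: J]) F j ->
  (lebesgue_measure A <= \sum_j lebesgue_measure (F j))%E.
Proof.
move=> mF mA AF.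
have H (s : seq J) : measurable (\big[setU/set0]_(j <- s) F j) /\
    (lebesgue_measure (\big[setU/set0]_(j <- s) F j)
      <= \sum_(j <- s) lebesgue_measure (F j))%E.
  elim: s => [|j s [IH1 IH2]]; first by rewrite !big_nil measure0.
  rewrite !big_cons; split; first exact: measurableU.
  apply: (le_trans (measureU2 _ _ _)); [exact: mF|exact: IH1|exact: leeD2l].
have [mU leU] := H (index_enum J).
apply: le_trans leU; apply: lebesgue_measure_le => // x /AF[j _ Fx].
by rewrite (bigD1 j)//=; left.
Qed.

(** * Consequences of the open set condition *)

Lemma measure_disjoint_le (R : realType) (J : finType) (F : J -> set R) (A : set R) :
  (forall j, measurable (F j)) -> measurable A ->
  (forall i j, i != j -> F i `&` F j = set0) -> (forall j, F j `<=` A) ->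
  (\sum_j lebesgue_measure (F j) <= lebesgue_measure A)%E.
Proof.
move=> mF mA dF FA.
pose D := [set` index_enum J].
have tF : trivIset D F by apply/trivIsetP => i j _ _; exact: dF.
have UA : \bigcup_(j in D) F j `<=` A by move=> x [j _]; exact: FA.
have fD : finite_set D by exact: finite_seq.
have mU : measurable (\bigcup_(j in D) F j) by exact: fin_bigcup_measurable.
rewrite fsbig_seq ?index_enum_uniq//.
rewrite -(@measure_fin_bigcup _ _ _ (@lebesgue_measure R) J D F fD tF
  (fun j _ => mF j)).
exact: lebesgue_measure_le.
Qed.

(** Boundedness makes the measure of [U] finite, so that it can be cancelled when comparing [U] with
    its images. *)
Definition bounded_osc_set (R : realType) (N : nat) (S : 'I_N -> R -> R)
    (U : set R) : Prop :=
  [/\ open U, U !=set0, (exists M, U `<=` ball 0 M),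
      forall i, S i @` U `<=` U &
      forall i j, i != j -> (S i @` U) `&` (S j @` U) = set0].

Lemma open_set_condition_bounded (R : realType) (N : nat) (S : 'I_N -> R -> R)
    (r : 'I_N -> R) :
  (forall i, 0 < r i < 1) -> (forall i, similarity (r i) (S i)) ->
  open_set_condition S -> exists U, bounded_osc_set S U.
Proof.
move=> hr hS [U [oU [x0 Ux0] SU dU]].
have t0 i : 0 <= `|S i 0| / (1 - r i).
  by have /andP[_ r1] := hr i; rewrite divr_ge0// subr_ge0 ltW.
(* Exceeding every [|S i 0| / (1 - r i)] makes the ball of radius [M] invariant under each [S i];
   exceeding [|x0|] keeps [x0] in it. *)
pose M := 1 + `|x0| + \sum_i `|S i 0| / (1 - r i).
have M0 : 0 < M by rewrite ltr_pwDl ?sumr_ge0// ltr_pwDl.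
have SB i x : `|x| < M -> `|S i x| < M.
  move=> xM; have /andP[r0 r1] := hr i.
  have h1 : `|S i x| <= `|S i 0| + r i * `|x|.
    have := hS i x 0; rewrite subr0 => <-.
    by rewrite -{1}(subrKC (S i 0) (S i x)) ler_normD.
  have h2 : `|S i 0| <= M * (1 - r i).
    rewrite -ler_pdivrMr ?subr_gt0// /M (bigD1 i)//= addrCA lerDl.
    by rewrite addr_ge0// sumr_ge0.
  have h3 : r i * `|x| < r i * M by rewrite ltr_pM2l.
  lra.
exists (U `&` ball 0 M); split.
- by apply: openI => //; exact: ball_open.
- exists x0; split=> //; rewrite -ball_normE /= sub0r normrN /M.
  by rewrite -addrA addrCA ltrDl ltr_pwDl ?sumr_ge0.
- by exists M; exact: subIsetr.
- move=> i _ [x [Ux xM] <-]; split; first by apply: SU; exists i => //; exists x.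
  by move: xM; rewrite -ball_normE /= !sub0r !normrN; exact: SB.
- move=> i j ij; apply/seteqP; split=> // y [[x [Ux _] xy] [z [Uz _] zy]].
  by rewrite -(dU i j ij); split; [exists x|exists z].
Qed.

Lemma open_bounded_measure (R : realType) (U : set R) (M : R) :
  open U -> U !=set0 -> U `<=` ball 0 M ->
  exists2 v : R, 0 < v & lebesgue_measure U = v%:E.
Proof.
move=> oU [x Ux] UM.
have mU : measurable U by exact: open_measurable.
have /interior_dist[d d0 dU] : interior U x by move/interior_id : oU => ->.
have M0 : 0 <= M.
  by have := UM _ Ux; rewrite -ball_normE /= => /ltW; exact: le_trans.
have leM : (lebesgue_measure U <= (M *+ 2)%:E)%E.
  rewrite -(@lebesgue_measure_ball R 0)//.
  by apply: lebesgue_measure_le => //; exact: measurable_ball.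
have leU : ((d *+ 2)%:E <= lebesgue_measure U)%E.
  rewrite -(@lebesgue_measure_ball R x); last exact: ltW.
  apply: lebesgue_measure_le; [exact: measurable_ball|exact: mU|].
  by move=> y; rewrite -ball_normE; exact: dU.
have fU : lebesgue_measure U \is a fin_num.
  by rewrite ge0_fin_numE ?measure_ge0// (le_lt_trans leM) ?ltry.
exists (fine (lebesgue_measure U)); last by rewrite fineK.
by rewrite -lte_fin fineK// (lt_le_trans _ leU)// lte_fin mulrn_wgt0.
Qed.

Lemma sum_ratio_le1 (R : realType) (N : nat) (S : 'I_N -> R -> R)
    (r : 'I_N -> R) (U : set R) :
  (forall i, 0 < r i < 1) -> (forall i, similarity (r i) (S i)) ->
  bounded_osc_set S U -> \sum_i r i <= 1.
Proof.
move=> hr hS [oU U0 [M UM] SU dU].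
have [v v0 vE] := open_bounded_measure oU U0 UM.
have mU : measurable U by exact: open_measurable.
have mSU i := similarity_measure (andP (hr i)).1 (hS i) mU.
have := measure_disjoint_le (fun i => (mSU i).1) mU dU SU.
rewrite (eq_bigr (fun i => (r i * v)%:E)) => [|i _]; last first.
  by rewrite (mSU i).2 vE EFinM.
by rewrite sumEFin vE lee_fin -mulr_suml ger_pMl.
Qed.

(** In the equality case the images fill [U] up to measure zero, hence densely. Following a point of
    [U] back through the images shows that it is arbitrarily close to [K], which is closed. *)
Lemma sum_ratio_eq1 (R : realType) (N : nat) (S : 'I_N -> R -> R)
    (r : 'I_N -> R) (U K : set R) :
  attractor S r K -> bounded_osc_set S U -> \sum_i r i = 1 -> U `<=` K.
Proof.
move=> [[[k0 Kk0] cK] hr hS KE] [oU U0 [M UM] SU dU] sum1.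
have [v v0 vE] := open_bounded_measure oU U0 UM.
have mU : measurable U by exact: open_measurable.
have mSU i := similarity_measure (andP (hr i)).1 (hS i) mU.
(* A ball missed by all images would remove a positive measure [w], giving [v <= v - w]. *)
have dense (x d : R) : U x -> 0 < d -> exists i, exists2 y, U y & `|x - S i y| < d.
  move=> Ux d0; apply: contrapT => none.
  have oB : open (U `&` ball x d) by apply: openI => //; exact: ball_open.
  have mB : measurable (U `&` ball x d) by exact: open_measurable.
  have [w w0 wE] : exists2 w : R, 0 < w & lebesgue_measure (U `&` ball x d) = w%:E.
    apply: (@open_bounded_measure _ _ M) => //; last by move=> y [/UM].
    by exists x; split=> //; exact: ballxx.
  have dSB i : (S i @` U) `<=` U `\` (U `&` ball x d).
    move=> y SUy; split; first exact: SU SUy.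
    move=> [_]; rewrite -ball_normE /= => xy; apply: none; exists i.
    by have [z Uz zE] := SUy; exists z => //; rewrite zE.
  have mD : measurable (U `\` (U `&` ball x d)) by exact: measurableD.
  have := measure_disjoint_le (fun i => (mSU i).1) mD dU dSB.
  rewrite (eq_bigr (fun i => (r i * v)%:E)) => [|i _]; last first.
    by rewrite (mSU i).2 vE EFinM.
  have Ufin : (lebesgue_measure U < +oo)%E by rewrite vE ltry.
  have -> : lebesgue_measure (U `\` (U `&` ball x d)) = (v - w)%:E.
    rewrite EFinB -vE -wE; have := @measureD _ _ _ lebesgue_measure _ _ mU mB Ufin.
    by rewrite setIA setIid.
  by rewrite sumEFin -mulr_suml sum1 mul1r lee_fin; lra.
have [rho /andP[r0 r1] hrho] := ratio_upper_bound hr.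
(* Approximating within [(1 - rho) / 2 * L] and then contracting an error [L] by [rho] leaves a
   total of [(1 + rho) / 2 * L], with a factor below 1. *)
have step L : 0 < L -> (forall a, U a -> exists2 k, K k & `|a - k| <= L) ->
    forall a, U a -> exists2 k, K k & `|a - k| <= (1 + rho) / 2 * L.
  move=> L0 hL a Ua.
  have [|i [b Ub ab]] := dense a ((1 - rho) / 2 * L) Ua.
    by rewrite mulr_gt0// divr_gt0// subr_gt0.
  have [k Kk bk] := hL b Ub; exists (S i k).
    by rewrite KE; exists i => //; exists k.
  have h1 : `|S i b - S i k| <= rho * L.
    by rewrite hS ler_pM//; have /andP[/ltW] := hr i.
  have h2 := ler_distD (S i b) a (S i k).
  lra.
have [M' M'0 hM'] : exists2 M' : R, 0 < M' & forall a, U a -> `|a - k0| <= M'.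
  exists (`|M| + `|k0| + 1) => [|a /UM]; first by rewrite ltr_wpDl// addr_ge0.
  rewrite -ball_normE /= sub0r normrN => aM.
  by have := ler_normB a k0; have := ler_norm M; lra.
have iter n : forall a, U a -> exists2 k, K k & `|a - k| <= ((1 + rho) / 2) ^+ n * M'.
  elim: n => [a Ua|n IH]; first by exists k0; rewrite // expr0 mul1r hM'.
  by rewrite exprS -mulrA; apply: step IH; rewrite mulr_gt0// exprn_gt0//; lra.
move=> a Ua; have clK : closed K by apply: compact_closed => //; exact: norm_hausdorff.
apply: clK => B /nbhs_ballP[d /= d0 dB].
have [|n hn] := @exprn_small R ((1 + rho) / 2) M' d _ d0.
  by apply/andP; split; lra.
have [k Kk ak] := iter n a Ua; exists k; split=> //; apply: dB.
by rewrite -ball_normE /= (le_lt_trans ak).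
Qed.

(** * Volume of the parallel sets *)

Lemma powR_exponent_continuous (R : realType) (a : R) :
  0 < a -> continuous (fun t : R => a `^ t).
Proof.
move=> a0; rewrite /powR gt_eqF// => t.
apply: (@continuous_comp _ _ _ (fun t : R => t * ln a) expR).
  by apply: cvgM; [exact: cvg_id|exact: cvg_cst].
exact: continuous_expR.
Qed.

(** The sum is at least 1 at exponent 0, since some index satisfies [P], and below 1 at exponent 1,
    so the intermediate value theorem applies. The predicate [P] allows one piece to be left out. *)
Lemma similarity_exponent (R : realType) (J : finType) (sg : J -> R) (P : pred J) :
  (forall j, 0 < sg j < 1) -> (exists j, P j) -> \sum_(j | P j) sg j < 1 ->
  exists2 D : R, 0 <= D < 1 & \sum_(j | P j) sg j `^ D = 1.
Proof.
move=> hsg [j0 Pj0] sum1; pose f t := \sum_(j | P j) sg j `^ t.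
have f1 : f 1 < 1.
  by rewrite /f (eq_bigr sg)// => j _; rewrite powRr1//; have /andP[/ltW] := hsg j.
have f0 : 1 <= f 0.
  rewrite /f (bigD1 j0)//= powRr0 lerDl sumr_ge0// => j _; exact: powR_ge0.
have cf : continuous f.
  have cs (s : seq J) : continuous (fun t => \sum_(j <- s | P j) sg j `^ t).
    elim: s => [|j s IH] t.
      by under eq_fun do rewrite big_nil; exact: cvg_cst.
    under eq_fun do rewrite big_cons; case: (P j); last exact: IH.
    apply: cvgD; last exact: IH.
    by apply: powR_exponent_continuous; have /andP[] := hsg j.
  exact: cs.
have [||D] := @IVT R f 0 1 1 ler01.
- exact: continuous_subspaceT.
- by rewrite ge_min le_max f0 (ltW f1) orbT.
- rewrite in_itv/= => /andP[D0 D1] fD; exists D => //; rewrite D0 lt_neqAle D1 andbT.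
  by apply/eqP => DE; move: f1; rewrite -{1}DE fD ltxx.
Qed.

(** After taking logarithms, the volume differs from [p * ln e] by at most [|ln c| + |ln C|], which
    is negligible against [ln e]. *)
Lemma minkowski_dim_power (R : realType) (F : set R) (p c C e0 : R) :
  0 < c -> 0 < C -> 0 < e0 ->
  (forall e, 0 < e < e0 -> ((c * e `^ p)%:E <= lebesgue_measure (parallel_set F e))%E /\
    (lebesgue_measure (parallel_set F e) <= (C * e `^ p)%:E)%E) ->
  minkowski_dim F = 1 - p.
Proof.
move=> c0 C0 e0_gt0 hF; rewrite /minkowski_dim; congr (_ - _).
apply: cvg_lim; first exact: norm_hausdorff.
apply/cvgrPdist_lt => eta eta0; near=> e.
have e_gt0 : 0 < e by near: e; exact: nbhs_right_gt.
have ee0 : e < e0 by near: e; exact: nbhs_right_lt.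
have e1 : e < 1 by near: e; exact: nbhs_right_lt.
pose M := `|ln c| + `|ln C|.
(* Below this threshold [eta * |ln e|] exceeds [M]. *)
have eM : e < expR (- (M / eta)) by near: e; apply: nbhs_right_lt; exact: expR_gt0.
have [|lo up] := hF e; first by rewrite e_gt0.
have ep0 : 0 < e `^ p by exact: powR_gt0.
have fW : lebesgue_measure (parallel_set F e) \is a fin_num.
  by rewrite ge0_fin_numE ?measure_ge0// (le_lt_trans up) ?ltry.
move: lo up; rewrite -(fineK fW) !lee_fin; set W := fine _ => lo up.
have W0 : 0 < W by rewrite (lt_le_trans _ lo)// mulr_gt0.
have lo' : ln c + p * ln e <= ln W.
  by rewrite -ln_powR -lnM ?posrE// ler_ln ?posrE// mulr_gt0.
have up' : ln W <= ln C + p * ln e.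
  by rewrite -ln_powR -lnM ?posrE// ler_ln ?posrE// mulr_gt0.
have lne : ln e < - (M / eta) by rewrite -ltr_expR lnK.
have lne0 : ln e < 0 by rewrite ln_lt0// e_gt0.
rewrite -(@ltr_pM2r _ `|ln e|) ?normr_gt0 ?lt_eqF// -normrM mulrBl divfK ?lt_eqF//.
rewrite (ltr0_norm lne0) (@le_lt_trans _ _ M)//.
  rewrite ler_norml /M; have := ler_norm (ln C); have := ler_norm (- ln c).
  by rewrite normrN; have := normr_ge0 (ln c); have := normr_ge0 (ln C); lra.
by rewrite mulrC -ltr_pdivrMr// ltrNr.
Unshelve. all: by end_near. Qed.

Lemma parallel_measure_bounded (R : realType) (K : set R) (e : R) :
  compact K -> exists2 M : R, 0 < M &
    (lebesgue_measure (parallel_set K e) <= M%:E)%E.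
Proof.
move=> cK; have [M [_ hM]] := compact_bounded cK.
pose L := `|M| + 1 + `|e| + 1.
have L0 : 0 < L by rewrite ltr_wpDl// !addr_ge0.
exists (L *+ 2); first by rewrite mulrn_wgt0.
rewrite -(@lebesgue_measure_ball R 0); last exact: ltW.
apply: lebesgue_measure_le; [exact: measurable_parallel_set|exact: measurable_ball|].
move=> y /(parallel_set_le (ler_norm e)); rewrite parallel_setP// => -[k Kk yk].
rewrite -ball_normE /= sub0r normrN /L.
have kM : `|k| <= `|M| + 1 by apply: hM => //; rewrite ltr_pwDr// ler_norm.
have := ler_normD (y - k) k; rewrite subrK; lra.
Qed.

(** Summed over ratios whose [D]-th powers add up to 1, the right-hand sides give back the power law
    at [e], which therefore passes from the scales [e / s] to [e]. *)
Lemma powR_rescale (R : realType) (s e C D : R) :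
  0 < s -> 0 <= e -> s * (C * (e / s) `^ (1 - D)) = C * e `^ (1 - D) * s `^ D.
Proof.
move=> s0 e0; have s0' := ltW s0.
rewrite powRM ?invr_ge0// -powR_inv1// -powRrM mulN1r opprB (@powRB _ s).
  by rewrite powRr1//; field; exact: lt0r_neq0.
by rewrite (gt_eqF s0) implybT.
Qed.

Lemma parallel_measure_upper (R : realType) (J : finType) (g : J -> R -> R)
    (sg : J -> R) (K : set R) (D : R) :
  attractor g sg K -> D <= 1 -> \sum_j sg j `^ D = 1 ->
  exists2 C : R, 0 < C & forall e, 0 < e <= 1 ->
    (lebesgue_measure (parallel_set K e) <= (C * e `^ (1 - D))%:E)%E.
Proof.
move=> gK D1 sumD; have [[_ cK] hsg gsim KE] := gK.
have [tau /andP[tau0 tau1] htau] := ratio_lower_bound hsg.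
have [M M0 hM] := parallel_measure_bounded 1 cK.
have t0 : 0 < tau `^ (1 - D) by exact: powR_gt0.
(* [M] bounds the volume on the whole starting window from [tau] to 1, where the power of [e] is
   least at [tau]. *)
pose C := M / tau `^ (1 - D); have C0 : 0 < C by rewrite divr_gt0.
exists C => //; apply: (@scale_induction R J sg _ tau) => //
  [j|e /andP[te e1]|e /andP[e_gt0 et] IH].
- by rewrite mulr1.
- apply: (@le_trans _ _ M%:E).
    apply: le_trans hM; apply: lebesgue_measure_le; last exact: parallel_set_le.
      exact: measurable_parallel_set.
    exact: measurable_parallel_set.
  rewrite lee_fin /C mulrAC ler_pdivlMr// ler_pM2l//.
  by rewrite ge0_ler_powR ?nnegrE ?subr_ge0 ?(ltW tau0)// (le_trans (ltW tau0)).
- have mS j := similarity_measure (andP (hsg j)).1 (gsim j)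
    (measurable_parallel_set K (e / sg j)).
  have cov : parallel_set K e `<=`
      \bigcup_(j in [set: J]) (g j @` parallel_set K (e / sg j)).
    by move=> y /(parallel_set_cover gK e_gt0)[j [_ [x ? ?]]]; exists j => //; exists x.
  apply: (le_trans (measure_bigcup_le (fun j => (mS j).1)
    (measurable_parallel_set K e) cov)).
  apply: (@le_trans _ _ (\sum_j (sg j * (C * (e / sg j) `^ (1 - D)))%:E)%E).
    apply: lee_sum => j _; rewrite (mS j).2 EFinM.
    have /andP[sj0 _] := hsg j.
    by apply: lee_wpmul2l; [rewrite lee_fin ltW|exact: IH].
  rewrite sumEFin lee_fin (eq_bigr (fun j => C * e `^ (1 - D) * sg j `^ D)).
    by rewrite -mulr_sumr sumD mulr1.
  by move=> j _; have /andP[sj0 _] := hsg j; rewrite powR_rescale// ltW.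
Qed.

(* Inside [U] the pieces are disjoint, so the measure of [U `&` parallel_set K e]
   is at least its recursive counterpart; for large [e] it is that of [U]. *)
Lemma parallel_measure_lower (R : realType) (N : nat) (S : 'I_N -> R -> R)
    (r : 'I_N -> R) (K U : set R) (D : R) :
  attractor S r K -> bounded_osc_set S U -> D <= 1 -> \sum_j r j `^ D = 1 ->
  exists2 c : R, 0 < c & exists2 e1 : R, 0 < e1 & forall e, 0 < e <= e1 ->
    ((c * e `^ (1 - D))%:E <= lebesgue_measure (parallel_set K e))%E.
Proof.
move=> gK [oU U0 [M UM] SU dU] D1 sumD; have [[[k0 Kk0] cK] hr hS KE] := gK.
have [tau /andP[tau0 tau1] htau] := ratio_lower_bound hr.
have [v v0 vE] := open_bounded_measure oU U0 UM.
have mU : measurable U by exact: open_measurable.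
have mUK e : measurable (U `&` parallel_set K e).
  by apply: measurableI => //; exact: measurable_parallel_set.
(* From this scale on, the single point [k0] of [K] already puts all of [U] in the parallel set. *)
pose e0 := `|M| + `|k0| + 1.
have e0_gt0 : 0 < e0 by rewrite ltr_wpDl// addr_ge0.
have full e : e0 <= e -> U `&` parallel_set K e = U.
  move=> e0e; apply/setIidPl => y /UM; rewrite -ball_normE /= sub0r normrN => yM.
  rewrite parallel_setP ?(le_trans (ltW e0_gt0))//; exists k0 => //.
  by move: e0e; rewrite /e0; have := ler_normB y k0; have := ler_norm M; lra.
pose e1 := e0 / tau; have e1_gt0 : 0 < e1 by rewrite divr_gt0.
have p0 : 0 < e1 `^ (1 - D) by exact: powR_gt0.
(* This makes the claimed bound at most [v], the measure of [U], on the window from [e0] to [e1]. *)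
pose c := v / e1 `^ (1 - D); have c0 : 0 < c by rewrite divr_gt0.
exists c => //; exists e1 => //.
have H : forall e, 0 < e <= e1 ->
    ((c * e `^ (1 - D))%:E <= lebesgue_measure (U `&` parallel_set K e))%E.
  apply: (@scale_induction R _ r _ e0) => // [j|e /andP[e0e ee1]|e /andP[e_gt0 ee0] IH].
  - by rewrite /e1 mulrCA ler_pMr// ler_pdivlMr// mul1r.
  - rewrite full// vE lee_fin /c mulrAC ler_pdivrMr// ler_pM2l//.
    by rewrite ge0_ler_powR ?nnegrE ?subr_ge0 ?(ltW e1_gt0)// (le_trans (ltW e0_gt0)).
  have mS j := similarity_measure (andP (hr j)).1 (hS j) (mUK (e / r j)).
  have sub j : S j @` (U `&` parallel_set K (e / r j)) `<=` U `&` parallel_set K e.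
    move=> _ [x [Ux Kx] <-]; split; first by apply: SU; exists x.
    by apply: (parallel_set_piece (j := j) gK e_gt0); exists x.
  have dj i j : i != j -> (S i @` (U `&` parallel_set K (e / r i))) `&`
      (S j @` (U `&` parallel_set K (e / r j))) = set0.
    move=> ij; apply/seteqP; split=> // y [[x [Ux _] xy] [z [Uz _] zy]].
    by rewrite -(dU i j ij); split; [exists x|exists z].
  apply: (le_trans _ (measure_disjoint_le (fun j => (mS j).1) (mUK e) dj sub)).
  apply: (@le_trans _ _ (\sum_j (r j * (c * (e / r j) `^ (1 - D)))%:E)%E); last first.
    apply: lee_sum => j _; rewrite (mS j).2 EFinM.
    have /andP[sj0 _] := hr j.
    by apply: lee_wpmul2l; [rewrite lee_fin ltW|exact: IH].
  rewrite sumEFin lee_fin (eq_bigr (fun j => c * e `^ (1 - D) * r j `^ D)).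
    by rewrite -mulr_sumr sumD mulr1.
  by move=> j _; have /andP[sj0 _] := hr j; rewrite powR_rescale// ltW.
move=> e he; apply: (le_trans (H e he)); apply: lebesgue_measure_le => //.
exact: measurable_parallel_set.
Qed.

(** * Local flatness and frontier points *)

(** The preimage of the midpoint of [0, 1] is interior: a ball of radius [1 / (2 c)] about it is
    mapped into [0, 1], and injectivity puts that ball in [K]. *)
Lemma locally_flat_interior (R : realType) (K : set R) :
  K !=set0 -> locally_flat K -> interior K !=set0.
Proof.
move=> [x Kx] /(_ x Kx 1 ltr01)[a [b [ab _ _ [c [f [c0 hf fE]]]]]].
have [x0 _ fx0] : (f @` (`[a, b]%classic `&` K)) 2^-1.
  by rewrite fE /= in_itv /=; apply/andP; split; lra.
exists x0; apply/interior_dist; exists ((2 * c)^-1) => [|y x0y].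
  by rewrite invr_gt0 mulr_gt0.
have fxy : `|f x0 - f y| < 2^-1.
  by rewrite hf mulrC -ltr_pdivlMr// -invfM.
have : (f @` (`[a, b]%classic `&` K)) (f y).
  rewrite fE /= in_itv /=; move: fxy; rewrite fx0 ltr_norml => /andP[? ?].
  by apply/andP; split; lra.
by move=> [z [_ Kz]] /(similarity_inj c0 hf) <-.
Qed.

(** A copy of [K] within [e] of [x] inherits interior points, so it contains an interval, on which
    the trace of [K] is the interval itself. *)
Lemma interior_locally_flat (R : realType) (J : finType) (g : J -> R -> R)
    (sg : J -> R) (K : set R) :
  attractor g sg K -> \sum_j sg j <= 1 -> interior K !=set0 -> locally_flat K.
Proof.
move=> gK sum1 [z zK] x Kx e e0.
have [J' [g' [sg' [j0 [gK' _ hj0]]]]] := attractor_zoom gK sum1 Kx e0.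
have [_ hsg' gsim' KE'] := gK'.
have sub : g' j0 @` K `<=` K by move=> _ [k Kk <-]; exact: attractor_sub gK' Kk.
have /interior_dist[d d0 hd] :=
  similarity_interior (andP (hsg' j0)).1 (gsim' j0) zK.
move: (g' j0 z) hd => y hd.
have CK u : `[y - d / 2, y + d / 2]%classic u -> (g' j0 @` K) u.
  rewrite /= in_itv /= => /andP[? ?]; apply: hd.
  by rewrite ltr_norml; apply/andP; split; lra.
exists (y - d / 2), (y + d / 2); split.
- lra.
- move=> u /CK[k Kk <-]; have := hj0 k Kk; rewrite /= in_itv /= ltr_norml => /andP[? ?].
  by apply/andP; split; lra.
- exists y; split; last by apply: sub; apply: hd; rewrite subrr normr0.
  apply/interior_dist; exists (d / 2) => [|u]; first by rewrite divr_gt0.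
  by rewrite /= in_itv /= ltr_norml => /andP[? ?]; apply/andP; split; lra.
- have -> : `[y - d / 2, y + d / 2]%classic `&` K = `[y - d / 2, y + d / 2]%classic.
    by apply/setIidPl => u /CK/sub.
  exists d^-1, (fun u => (u - (y - d / 2)) / d); split; first by rewrite invr_gt0.
    move=> u v; rewrite -mulrBl normrM normfV (gtr0_norm d0) mulrC.
    by congr (_ * `|_|); ring.
  apply/seteqP; split=> [_ [u + <-]|u].
    rewrite /= in_itv /= => /andP[h1 h2]; rewrite in_itv /=; apply/andP; split.
      by apply: divr_ge0; lra.
    by rewrite ler_pdivrMr//; lra.
  rewrite /= in_itv /= => /andP[h1 h2].
  exists (u * d + (y - d / 2)); last by field; exact: lt0r_neq0.
  have : u * d <= 1 * d by rewrite ler_pM2r.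
  have : 0 <= u * d by rewrite mulr_ge0// ltW.
  by rewrite in_itv /= => ? ?; apply/andP; split; lra.
Qed.

(** * Frontier points and growth of volume *)

Lemma counting_le_size (R : realType) (X : set R) (s : seq R) :
  X `<=` [set` s] -> (counting X <= (size s)%:R%:E :> \bar R)%E.
Proof.
move=> Xs; have fX : finite_set X by exact: sub_finite_set Xs (finite_seq s).
rewrite /counting asboolT// lee_fin ler_nat.
apply: uniq_leq_size => [|x]; first exact: finmap.fset_uniq.
by rewrite in_fset_set// inE => /Xs.
Qed.

Lemma counting_le_seq (R : realType) (X : set R) (M : R) :
  (counting X <= M%:E)%E -> exists2 s : seq R, X = [set` s] & (size s)%:R <= M.
Proof.
rewrite /counting; case: asboolP => fX; last by rewrite leye_eq.
rewrite lee_fin => XM; exists (finmap.enum_fset (fset_set X)) => //.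
by rewrite -[LHS](fset_setK fX).
Qed.

(* The point of [A] nearest to [b] cannot be interior: it could be moved
   towards [b]. *)
Lemma closed_frontier_between (R : realType) (A : set R) (a b : R) :
  closed A -> A a -> ~ A b -> exists2 p, frontier A p & `|b - p| <= `|b - a|.
Proof.
(* Cutting [A] by this segment, which contains [a], gives a compact set, in which a point nearest to
   [b] exists. *)
move=> cA Aa Ab; pose I := `[b - `|b - a|, b + `|b - a|]%classic `&` A.
have Ia : I a.
  split=> //=; rewrite in_itv /=.
  have := ler_norm (b - a); have := ler_norm (a - b); rewrite distrC => ? ?.
  by apply/andP; split; lra.
have cI : compact I by apply: compact_closedI => //; exact: segment_compact.
have [||p /set_mem [_ Ap] pmin] := @compact_EVT_min R R (fun p => `|b - p|) I _ cI.
- by exists a.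
- apply: continuous_subspaceT => x; apply: cvg_norm.
  by apply: cvgB; [exact: cvg_cst|exact: cvg_id].
have pa : `|b - p| <= `|b - a| by apply: pmin; rewrite inE.
exists p => //; split; first exact: subset_closure.
move=> /interior_dist[d d0 hd].
have L0 : 0 < `|b - p|.
  by rewrite normr_gt0 subr_eq0; apply/eqP => bp; apply: Ab; rewrite bp.
set L := `|b - p| in L0 pmin pa.
(* With this choice [t < 1] and [t * L < d], so the moved point stays in the ball about [p] and
   comes closer to [b]. *)
pose t := d / (d + L); have dL0 : 0 < d + L by rewrite addr_gt0.
have t0 : 0 < t by rewrite divr_gt0.
have t1 : t < 1 by rewrite ltr_pdivrMr// mul1r ltrDl.
pose q := p + t * (b - p).
have Aq : A q.
  apply: hd; rewrite /q opprD addNKr normrN normrM gtr0_norm// -/L /t.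
  by rewrite mulrAC ltr_pdivrMr// ltr_pM2l// ltrDr.
have bq : `|b - q| = (1 - t) * L.
  have -> : b - q = (1 - t) * (b - p) by rewrite /q; ring.
  by rewrite normrM gtr0_norm// subr_gt0.
have bqL : `|b - q| < L by rewrite bq; have := mulr_gt0 t0 L0; lra.
suff /pmin : q \in I by rewrite leNgt bqL.
rewrite inE; split=> //=; rewrite in_itv /=; move: (lt_le_trans bqL pa).
by rewrite ltr_norml => /andP[? ?]; apply/andP; split; lra.
Qed.

(** By induction on [l], each listed point enlarges [B] by a closed interval of length [2 d]. *)
Lemma measure_cover_seq (R : realType) (d : R) (l : seq R) (A B : set R) :
  0 <= d -> measurable A -> measurable B ->
  (forall x, A x -> B x \/ exists2 p, p \in l & `|x - p| <= d) ->
  (lebesgue_measure A <= lebesgue_measure B + ((size l)%:R * (d *+ 2))%:E)%E.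
Proof.
move=> d0 mA; elim: l B => [|p l IH] B mB AB.
  rewrite mul0r adde0; apply: lebesgue_measure_le => // x /AB[//|[p]].
  by rewrite in_nil.
pose P := `[p - d, p + d]%classic; have mP : measurable P by exact: measurable_itv.
apply: (le_trans (IH (B `|` P) _ _)); first exact: measurableU.
  move=> x /AB[Bx|[q]]; first by left; left.
  rewrite in_cons => /predU1P[->|ql] xq; last by right; exists q.
  left; right; rewrite /P /= in_itv /=; move: xq; rewrite ler_norml => /andP[? ?].
  by apply/andP; split; lra.
have PE : (lebesgue_measure P <= (d *+ 2)%:E)%E.
  rewrite /P lebesgue_measure_itv /= lte_fin; case: ifP => _.
    by rewrite -EFinB lee_fin mulr2n; lra.
  by rewrite lee_fin mulrn_wge0.
have -> : (((size (p :: l))%:R * (d *+ 2))%:E =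
    (d *+ 2)%:E + ((size l)%:R * (d *+ 2))%:E :> \bar R)%E.
  by rewrite -EFinD /= -natr1; congr EFin; ring.
rewrite addeA; apply: leeD => //.
apply: (@le_trans _ _ (lebesgue_measure B + lebesgue_measure P)%E); last exact: leeD2l.
exact: measureU2.
Qed.

(** A newly covered point [y] is within [h - e] of the point at distance [e] from [k] on the segment
    from [k] to [y]. That point is in the smaller parallel set, so a frontier point lies no farther
    from [y]. *)
Lemma parallel_measure_growth (R : realType) (K : set R) (e h : R) (l : seq R) :
  compact K -> 0 < e < h -> frontier (parallel_set K e) `<=` [set` l] ->
  (lebesgue_measure (parallel_set K h) <=
   lebesgue_measure (parallel_set K e) + ((size l)%:R * ((h - e) *+ 2))%:E)%E.
Proof.
move=> cK /andP[e0 eh] hl.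
apply: measure_cover_seq; [by lra|exact: measurable_parallel_set..|].
move=> y; rewrite parallel_setP//; last by lra.
move=> [k Kk yk]; have [?|yNe] := pselect (parallel_set K e y); [by left|right].
have eyk : e < `|y - k|.
  rewrite ltNge; apply/negP => ?; apply: yNe; rewrite parallel_setP ?ltW//.
  by exists k.
have L0 : 0 < `|y - k| by exact: lt_trans eyk.
set L := `|y - k| in yk eyk L0.
pose a := k + e / L * (y - k).
have ak : `|a - k| = e.
  by rewrite /a addrAC subrr add0r normrM ger0_norm ?divr_ge0 ?ltW// divfK// gt_eqF.
have ya : `|y - a| = L - e.
  rewrite (_ : y - a = (1 - e / L) * (y - k)); last by rewrite /a; ring.
  rewrite normrM ger0_norm -/L; last by rewrite subr_ge0 ler_pdivrMr// mul1r ltW.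
  by field; exact: lt0r_neq0.
have Ka : parallel_set K e a.
  by rewrite parallel_setP ?ltW//; exists k => //; rewrite ak.
have [p /hl pl yp] := closed_frontier_between (@closed_parallel_set R K e) Ka yNe.
by exists p => //; rewrite (le_trans yp)// ya; lra.
Qed.

(** * Frontier count when the attractor has interior *)

(** For [e] at least the diameter bound the parallel set has no gaps, so only its two extreme
    points, [e] beyond the minimum [a] and the maximum [b] of [K], can be frontier points. *)
Lemma frontier_parallel_far (R : realType) (K : set R) (M : R) :
  K !=set0 -> compact K -> 0 <= M -> (forall x y, K x -> K y -> `|x - y| <= M) ->
  exists a b, forall e, M <= e ->
    frontier (parallel_set K e) `<=` [set` [:: a - e; b + e]].
Proof.
move=> K0 cK M0 hM.
have cid : {within K, continuous (id : R -> R)}.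
  by apply: continuous_subspaceT => x; exact: cvg_id.
have [a /set_mem Ka amin] := compact_EVT_min K0 cK cid.
have [b /set_mem Kb bmax] := compact_EVT_max K0 cK cid.
exists a, b => e Me y; have e0 := le_trans M0 Me.
rewrite frontier_parallel_setE => -[+ yNint]; rewrite parallel_setP// => -[k Kk yk].
have ak : a <= k by apply: amin; rewrite inE.
have kb : k <= b by apply: bmax; rewrite inE.
have abM : b - a <= M by rewrite (le_trans (ler_norm _))// hM.
have far x : K x -> e <= `|y - x|.
  move=> Kx; rewrite leNgt; apply/negP => yx; apply: yNint; apply/interior_dist.
  exists (e - `|y - x|) => [|z yz]; first by rewrite subr_gt0.
  rewrite parallel_setP//; exists x => //.
  by have := ler_distD y z x; rewrite (distrC z y); lra.
have fa := far a Ka; have fb := far b Kb.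
rewrite /= !inE; have [kle|kgt] := leP k y.
  have yb : y = b + e.
    move: yk; rewrite ger0_norm ?subr_ge0// => yk.
    have [yb|yb] := leP y b.
      move: fb; rewrite distrC ger0_norm ?subr_ge0// => fb.
      move: fa; rewrite ger0_norm ?subr_ge0 ?(le_trans ak)// => fa.
      lra.
    by move: fb; rewrite gtr0_norm ?subr_gt0// => fb; lra.
  by rewrite yb eqxx orbT.
have ya : y = a - e.
  move: yk; rewrite distrC gtr0_norm ?subr_gt0// => yk.
  have [ya|ya] := leP y a.
    by move: fa; rewrite distrC ger0_norm ?subr_ge0// => fa; lra.
  move: fa; rewrite gtr0_norm ?subr_gt0// => fa.
  move: fb; rewrite distrC gtr0_norm ?subr_gt0 ?(lt_le_trans kgt)// => fb.
  lra.
by rewrite ya eqxx.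
Qed.

(** Without [j0] the ratios sum to less than 1, so their [t]-th powers sum to at most 1 for some
    [t < 1], and the bound propagates from large scales to small ones. *)
Lemma frontier_parallel_count (R : realType) (J : finType) (g : J -> R -> R)
    (sg : J -> R) (K : set R) (j0 : J) :
  attractor g sg K -> \sum_j sg j <= 1 -> (forall k, K k -> interior K (g j0 k)) ->
  exists2 t : R, 0 <= t < 1 & exists2 C : R, 0 < C & exists2 e1 : R, 0 < e1 &
    forall e, 0 < e <= e1 -> exists2 l : seq R,
      frontier (parallel_set K e) `<=` [set` l] & (size l)%:R <= C * e `^ (- t).
Proof.
move=> gK sum1 intj0; have [[K0 cK] hsg gsim KE] := gK.
have [t /andP[t0 t1] sumt] : exists2 t : R, 0 <= t < 1 &
    \sum_(j | j != j0) sg j `^ t <= 1.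
  have [ex|nex] := pselect (exists j, j != j0).
    have [|t t01 ht] := similarity_exponent hsg ex; last by exists t; rewrite ?ht.
    move: sum1; rewrite (bigD1 j0)//=; have /andP[s0 _] := hsg j0; lra.
  (* When [j0] is the only index the sum is empty and exponent 0 suffices. *)
  exists 0; first by rewrite lexx ltr01.
  by rewrite big1 => [|j jj0]; [exact: ler01|case: nex; exists j].
exists t; first by rewrite t0.
have [M M0 hM] := compact_dist_bound cK.
have [a [b far]] := frontier_parallel_far K0 cK (ltW M0) hM.
have [tau /andP[tau0 tau1] htau] := ratio_lower_bound hsg.
pose e1 := M / tau; have e1_gt0 : 0 < e1 by rewrite divr_gt0.
(* The bound is then at least 2 for all [e <= e1], which covers the two frontier points of the
   starting window. *)
pose C := 2 * e1 `^ t; have C0 : 0 < C by rewrite mulr_gt0// powR_gt0.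
exists C => //; exists e1 => //.
apply: (@scale_induction R J sg _ M) => // [j|e /andP[Me ee1]|e /andP[e_gt0 eM] IH].
- by rewrite /e1 mulrCA ler_pMr// ler_pdivlMr// mul1r.
- exists [:: a - e; b + e]; first exact: far.
  have e_gt0 : 0 < e by exact: lt_le_trans Me.
  rewrite /C -mulrA ler_pMr// powRN ler_pdivlMr ?powR_gt0// mul1r.
  by rewrite ge0_ler_powR// nnegrE ltW.
have /choice[l hl] : forall j, exists l : seq R,
    frontier (parallel_set K (e / sg j)) `<=` [set` l] /\
    (size l)%:R <= C * (e / sg j) `^ (- t).
  by move=> j; have [l l1 l2] := IH j; exists l.
exists (flatten [seq [seq g j x | x <- l j] | j <- index_enum J & j != j0]).
  move=> y /(frontier_parallel_cover gK e_gt0 intj0)[j jj0 [x /(hl j).1 xl xy]].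
  apply/flatten_mapP; exists j; first by rewrite mem_filter jj0 mem_index_enum.
  by rewrite -xy; exact: map_f.
rewrite size_flatten sumnE !big_map big_filter natr_sum.
apply: (@le_trans _ _ (\sum_(j | j != j0) C * e `^ (- t) * sg j `^ t)).
  apply: ler_sum => j _; rewrite size_map (le_trans (hl j).2)//.
  have /andP[s0 _] := hsg j; have s0' := ltW s0.
  by rewrite powRM ?invr_ge0// ?(ltW e_gt0)// -powR_inv1// -powRrM mulN1r opprK mulrA.
by rewrite -mulr_sumr ger_pMr// mulr_gt0// powR_gt0.
Qed.

Lemma powR_small (R : realType) (a d : R) :
  0 < a -> 0 < d -> exists2 x0 : R, 0 < x0 & forall x, 0 < x < x0 -> x `^ a < d.
Proof.
move=> a0 d0; have : \forall x \near (0 : R)^'+, x `^ a < d.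
  by apply: (cvgr_lt 0) => //; exact: powR_cvg0.
move=> /nbhs_ballP[x0 /= x0_gt0 hx]; exists x0 => // x /andP[x_gt0 xx0].
by apply: hx => //; rewrite -ball_normE /= sub0r normrN gtr0_norm.
Qed.

Lemma scaling_exponent0_le (R : realType) (K : set R) (t C e1 : R) :
  0 <= t < 1 -> 0 < C -> 0 < e1 ->
  (forall e, 0 < e <= e1 -> exists2 l : seq R,
      frontier (parallel_set K e) `<=` [set` l] & (size l)%:R <= C * e `^ (- t)) ->
  (scaling_exponent0 K < 1%:E)%E.
Proof.
(* The midpoint lies strictly between [t] and 1: it is below 1, and [e^s] times the count is at most
   [C e^(s-t)], which tends to 0. *)
move=> /andP[t0 t1] C0 e1_gt0 hK; pose s := (1 + t) / 2.
have s0 : 0 <= s by rewrite /s; lra.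
have ts : 0 < s - t by rewrite /s; lra.
apply: (@le_lt_trans _ _ s%:E); last by rewrite lte_fin /s; lra.
apply: ereal_inf_lbound; exists s => //; split=> //.
exists set0; split; first exact: negligible_set0.
pose h e : \bar R := (C * e `^ (s - t))%:E.
suff H : ((e `^ s)%:E * C0var (parallel_set K e))%E @[e --> (0 : R)^'+] --> 0%E.
  exact: cvg_within_filter H.
apply: (squeeze_cvge (f := fun=> 0%E) (h := h)).
- near=> e.
  have e_gt0 : 0 < e by near: e; exact: nbhs_right_gt.
  have ee1 : e <= e1 by near: e; exact: nbhs_right_le.
  have [|l /counting_le_size hl lC] := hK e; first by rewrite e_gt0.
  have c0 : (0 <= counting (frontier (parallel_set K e)) :> \bar R)%E.
    by rewrite /counting; case: asboolP => // _; rewrite lee_fin.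
  apply/andP; split.
    by rewrite /C0var !mule_ge0// lee_fin ?powR_ge0 ?invr_ge0.
  apply: (@le_trans _ _ ((e `^ s)%:E * (C * e `^ (- t))%:E)%E).
    apply: lee_wpmul2l; first by rewrite lee_fin powR_ge0.
    apply: (@le_trans _ _ (2^-1%:E * (C * e `^ (- t))%:E)%E).
      apply: lee_wpmul2l; first by rewrite lee_fin invr_ge0.
      by apply: (le_trans hl); rewrite lee_fin.
    rewrite -EFinM lee_fin ler_piMl ?mulr_ge0 ?powR_ge0 ?(ltW C0)//; lra.
  by rewrite -EFinM lee_fin mulrCA -powRD// (gt_eqF e_gt0) implybT.
- exact: cvg_cst.
- apply: cvg_EFin; first by near=> e.
  rewrite -[X in _ --> X](mulr0 C); apply: cvgM; first exact: cvg_cst.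
  exact: powR_cvg0.
Unshelve. all: by end_near. Qed.

(** * The scaling exponent of the attractor *)

Lemma negligible_avoid (R : realType) (Z : set R) (a b : R) :
  (@lebesgue_measure R).-negligible Z -> a < b -> exists2 x, a < x < b & ~ Z x.
Proof.
move=> [A [mA A0 ZA]] ab; apply: contrapT => none.
have abA : `]a, b[%classic `<=` A.
  move=> x; rewrite /= in_itv /= => axb; apply: ZA; apply: contrapT => nZ.
  by apply: none; exists x.
have mI : measurable (`]a, b[%classic : set R) by exact: measurable_itv.
have := lebesgue_measure_le mI mA abA.
rewrite lebesgue_measure_itv /= lte_fin ab -EFinB A0 lee_fin; lra.
Qed.

(** Between [h / 4] and [h / 2] some scale [e] avoids the exceptional null set, and there are at
    most [2 e^(-s)] frontier points at that scale. These control the growth of volume from [e] to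
    [h]. *)
Lemma ess_cvg0_growth (R : realType) (K : set R) (s : R) :
  compact K -> 0 <= s ->
  ess_cvg0 (fun e => ((e `^ s)%:E * C0var (parallel_set K e))%E) 0%E ->
  exists A d : R, [/\ 0 < A, 0 < d & forall h, 0 < h < d ->
    (lebesgue_measure (parallel_set K h) <=
     lebesgue_measure (parallel_set K (h / 2)) + (A * h `^ (1 - s))%:E)%E].
Proof.
move=> cK s0 [Z [nZ cvg0]].
have /cvg0 : nbhs (0%E : \bar R) [set x | (x < 1%:E)%E].
  by apply: open_nbhs_nbhs; split; [exact: open_ereal_lt_ereal|rewrite /= lte_fin].
move=> /nbhs_ballP[d /= d0 hd].
(* At most [2 e^(-s)] points each contribute at most [2 h], and [h <= 4 e] turns [e^(-s)] into
   [4^s h^(-s)]. *)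
exists (4 * 4 `^ s), d; split=> //.
move=> h /andP[h0 hd'].
have [|e /andP[he eh] Ze] := negligible_avoid (a := h / 4) (b := h / 2) nZ; first lra.
have e0 : 0 < e by lra.
have es0 : 0 < e `^ s by exact: powR_gt0.
have small : ((e `^ s)%:E * C0var (parallel_set K e) < 1%:E)%E.
  by apply: (hd e) => //; rewrite -ball_normE /= sub0r normrN gtr0_norm//; lra.
have [l fl lM] : exists2 l : seq R, frontier (parallel_set K e) = [set` l] &
    (size l)%:R <= 2 / e `^ s.
  apply: counting_le_seq; rewrite leNgt; apply/negP => big.
  move: small; apply/negP; rewrite -leNgt /C0var.
  have -> : 1%:E = ((e `^ s)%:E * (2^-1%:E * (2 / e `^ s)%:E))%E :> \bar R.
    by rewrite -!EFinM; congr EFin; field; exact: lt0r_neq0.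
  apply: lee_wpmul2l; first by rewrite lee_fin ltW.
  by apply: lee_wpmul2l; [rewrite lee_fin invr_ge0|exact: ltW].
have eh' : 0 < e < h by apply/andP; split; lra.
apply: (le_trans (@parallel_measure_growth R K e h l cK eh' _)); first by rewrite fl.
apply: leeD.
  apply: lebesgue_measure_le; [exact: measurable_parallel_set..|].
  by apply: parallel_set_le; lra.
rewrite lee_fin (@le_trans _ _ ((2 / e `^ s) * (h *+ 2)))//.
  by apply: ler_pM => //; rewrite ?mulrn_wge0 ?ler_wMn2r//; lra.
have hs : h `^ s <= 4 `^ s * e `^ s.
  by rewrite -powRM//; [apply: ge0_ler_powR; rewrite ?nnegrE//; lra|lra].
have hs0 : 0 < h `^ s by exact: powR_gt0.
have -> : h `^ (1 - s) = h / h `^ s.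
  by rewrite powRB ?(gt_eqF h0) ?implybT// powRr1// ltW.
have -> : 2 / e `^ s * (h *+ 2) = 4 * h / e `^ s by field; exact: lt0r_neq0.
have -> : 4 * 4 `^ s * (h / h `^ s) = 4 * h * (4 `^ s / h `^ s).
  by field; exact: lt0r_neq0.
by rewrite ler_pM2l ?mulr_gt0// ler_pdivlMr// mulrC ler_pdivrMr.
Qed.

(* The growth bound, telescoped along e, e/2, e/4 and so on, is geometric
   because s < 1, and the remainder V (e / 2^n) vanishes because D < 1. *)
Lemma growth_exponent_absurd (R : realType) (V : R -> R) (s D c C A e1 : R) :
  0 <= s -> s < D -> D < 1 -> 0 < c -> 0 < C -> 0 < A -> 0 < e1 ->
  (forall e, 0 < e < e1 -> c * e `^ (1 - D) <= V e <= C * e `^ (1 - D)) ->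
  (forall e, 0 < e < e1 -> V e <= V (e / 2) + A * e `^ (1 - s)) -> False.
Proof.
move=> s0 sD D1 c0 C0 A0 e1_gt0 Vb Vg.
pose q := 2^-1 `^ (1 - s).
have q1 : q < 1.
  have : 2^-1 `^ (1 - s) < 1 `^ (1 - s).
    by apply: gt0_ltr_powR; rewrite ?nnegrE//; lra.
  by rewrite powR1.
have q0 : 0 < q by exact: powR_gt0.
(* [B] is the sum of the geometric series with first term [A] and ratio [q], the factor gained by
   halving [e]. *)
pose B := A / (1 - q); have B0 : 0 < B by rewrite divr_gt0// subr_gt0.
have BA : B = A + B * q by rewrite /B; field; rewrite subr_eq0 gt_eqF.
have half e : 0 < e -> (e / 2) `^ (1 - s) = q * e `^ (1 - s).
  by move=> e0; rewrite powRM ?ltW// mulrC.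
have iter n : forall e, 0 < e < e1 -> V e <= B * e `^ (1 - s) + V (2^-1 ^+ n * e).
  elim: n => [e /andP[e0 _]|n IH e /andP[e0 ee1]].
    by rewrite expr0 mul1r lerDr mulr_ge0 ?ltW// powR_gt0.
  have := Vg e; rewrite e0 ee1 => /(_ isT) h1.
  have /IH h2 : 0 < e / 2 < e1 by apply/andP; split; lra.
  have -> : 2^-1 ^+ n.+1 * e = 2^-1 ^+ n * (e / 2) by rewrite exprSr; ring.
  by move: h2; rewrite half// => h2; rewrite BA mulrDl -(mulrA B); lra.
have main e : 0 < e < e1 -> V e <= B * e `^ (1 - s).
  move=> /[dup] he /andP[e0 ee1]; apply/ler_addgt0Pr => u u0.
  have [||x0 x0_gt0 hx0] := @powR_small R (1 - D) (u / C).
  - by rewrite subr_gt0.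
  - by rewrite divr_gt0.
  have [||n hn] := @exprn_small R 2^-1 e (Num.min x0 e1).
  - by rewrite invr_gt0 ltr0n invf_lt1 ?ltr0n ?ltr1n.
  - by rewrite lt_min x0_gt0.
  rewrite (le_trans (iter n e he))// lerD2l.
  have x_gt0 : 0 < 2^-1 ^+ n * e by rewrite mulr_gt0// exprn_gt0.
  move: hn; rewrite lt_min => /andP[hn1 hn2].
  have [|_ hV] := andP (Vb (2^-1 ^+ n * e) _); first by rewrite x_gt0.
  apply: (le_trans hV); rewrite mulrC -ler_pdivlMr// ltW// hx0//.
  by rewrite x_gt0.
have Ds : 0 < D - s by rewrite subr_gt0.
have cB : 0 < c / B by rewrite divr_gt0.
(* For small [e] the lower bound [c e^(1-D)] exceeds [B e^(1-s)], because [e^(D-s)] drops below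
   [c / B]. *)
have [x0 x0_gt0 hx0] := powR_small Ds cB.
pose e := Num.min x0 e1 / 2.
have m0 : 0 < Num.min x0 e1 by rewrite lt_min x0_gt0.
have e0 : 0 < e by rewrite divr_gt0.
have em : e < Num.min x0 e1 by rewrite /e; lra.
move: em; rewrite lt_min => /andP[ex0 ee1].
have he : 0 < e < e1 by rewrite e0.
have [h1 _] := andP (Vb e he).
have h2 := le_trans h1 (main e he).
have : e `^ (D - s) < c / B by apply: hx0; rewrite e0.
rewrite ltr_pdivlMr// => h3.
have p0 : 0 < e `^ (1 - D) by exact: powR_gt0.
move: h2; rewrite (_ : 1 - s = (D - s) + (1 - D)); last by ring.
rewrite powRD ?(gt_eqF e0) ?implybT// mulrA ler_pM2r//; lra.
Qed.

Lemma attractor_interior_dim (R : realType) (J : finType) (g : J -> R -> R)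
    (sg : J -> R) (K : set R) :
  attractor g sg K -> \sum_j sg j <= 1 -> interior K !=set0 ->
  (scaling_exponent0 K < 1%:E)%E /\ minkowski_dim K = 1.
Proof.
move=> gK sum1 [x /[dup] xK /interior_dist[d d0 hd]]; split.
  have Kx : K x by apply: hd; rewrite subrr normr0.
  (* Zooming in at the centre of a ball inside [K] yields a piece contained in the interior of
     [K]. *)
  have [J' [g' [sg' [j0 [gK' sum1' hj0]]]]] := attractor_zoom gK sum1 Kx d0.
  have int k : K k -> interior K (g' j0 k).
    move=> /hj0 xk; apply/interior_dist; exists (d - `|x - g' j0 k|) => [|y yk].
      by rewrite subr_gt0.
    by apply: hd; have := ler_distD (g' j0 k) x y; lra.
  have [t t01 [C C0 [e1 e1_gt0 hC]]] := frontier_parallel_count gK' sum1' int.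
  exact: scaling_exponent0_le t01 C0 e1_gt0 hC.
have [[_ cK] _ _ _] := gK.
have [M M0 hM] := parallel_measure_bounded 1 cK.
(* The volume is of order [e^0]: it is at least the length of a ball inside [K] and at most the
   volume at scale 1. *)
rewrite (@minkowski_dim_power R K 0 (d *+ 2) M 1) ?subr0// ?mulrn_wgt0//.
move=> e /andP[e0 e1]; rewrite !powRr0 !mulr1; split.
  rewrite -(@lebesgue_measure_ball R x); last exact: ltW.
  apply: lebesgue_measure_le; [exact: measurable_ball|exact: measurable_parallel_set|].
  move=> y; rewrite -ball_normE /= => /hd Ky; rewrite parallel_setP ?ltW//.
  by exists y => //; rewrite subrr normr0 ltW.
apply: le_trans hM; apply: lebesgue_measure_le; [exact: measurable_parallel_set..|].
exact/parallel_set_le/ltW.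
Qed.

(** The two volume bounds identify the Minkowski dimension with the similarity exponent [D]. An
    admissible [s < D] would force the volume below its lower bound. *)
Lemma thin_scaling_exponent0_ge (R : realType) (N : nat) (S : 'I_N -> R -> R)
    (r : 'I_N -> R) (K U : set R) :
  (0 < N)%N -> attractor S r K -> bounded_osc_set S U -> \sum_i r i < 1 ->
  ((minkowski_dim K)%:E <= scaling_exponent0 K)%E.
Proof.
move=> N0 SK hU sum1; have [[_ cK] hr _ _] := SK.
have [||D /andP[D0 D1] sumD] := @similarity_exponent R _ r xpredT hr _ _ => //.
  by exists (Ordinal N0).
have [C C0 hC] := parallel_measure_upper SK (ltW D1) sumD.
have [c c0 [e1 e1_gt0 hc]] := parallel_measure_lower SK hU (ltW D1) sumD.
pose e2 := Num.min e1 1; have e2_gt0 : 0 < e2 by rewrite lt_min e1_gt0 ltr01.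
have hb e : 0 < e < e2 ->
    ((c * e `^ (1 - D))%:E <= lebesgue_measure (parallel_set K e))%E /\
    (lebesgue_measure (parallel_set K e) <= (C * e `^ (1 - D))%:E)%E.
  rewrite lt_min => /and3P[e0 /ltW ee1 /ltW e1'].
  by split; [apply: hc|apply: hC]; rewrite e0.
rewrite (minkowski_dim_power c0 C0 e2_gt0 hb) (_ : 1 - (1 - D) = D); last by ring.
rewrite leNgt; apply/negP => /ereal_inf_lt[_ [s [s0 hs] <-]]; rewrite lte_fin => sD.
have [A [d [A0 d0 growth]]] := ess_cvg0_growth cK s0 hs.
have fin e : lebesgue_measure (parallel_set K e) \is a fin_num.
  have [M _ hM] := parallel_measure_bounded e cK.
  by rewrite ge0_fin_numE ?measure_ge0// (le_lt_trans hM)// ltry.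
pose V e := fine (lebesgue_measure (parallel_set K e)).
have VE e : lebesgue_measure (parallel_set K e) = (V e)%:E by rewrite fineK.
apply: (@growth_exponent_absurd R V s D c C A (Num.min e2 d)) => //.
- by rewrite lt_min e2_gt0.
- move=> e; rewrite lt_min => /and3P[e0 ee2 _].
  by have [|] := hb e; rewrite ?e0// VE !lee_fin => -> ->.
- move=> e; rewrite lt_min => /and3P[e0 _ ed].
  by have := growth e; rewrite e0 ed !VE -EFinD lee_fin; exact.
Qed.

Unset Implicit Arguments.

Theorem corollary4p9 (R : realType) (N : nat) (hN : (2 <= N)%N)
    (S : 'I_N -> R -> R) (r : 'I_N -> R) (K : set R)
    (hr : forall i, 0 < r i < 1)
    (hS : forall i, similarity (r i) (S i))
    (hK : self_similar_set S K)
    (hOSC : open_set_condition S) :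
  ((scaling_exponent0 K < (minkowski_dim K)%:E)%E <-> locally_flat K) /\
  (locally_flat K -> minkowski_dim K = 1).
Proof.
have [K0 cK KE] := hK; have SK : attractor S r K by [].
have [U hU] := open_set_condition_bounded hr hS hOSC.
have sum1 := sum_ratio_le1 hr hS hU.
have flat : locally_flat K -> (scaling_exponent0 K < 1%:E)%E /\ minkowski_dim K = 1.
  by move=> /(locally_flat_interior K0); exact: attractor_interior_dim SK sum1.
split; last by move=> /flat[].
split=> [lt_dim|/flat[? ->]//].
(* A sum below 1 contradicts [lt_dim]; otherwise the sum equals 1 and the open set [U] supplies
   interior points of [K]. *)
have [sum_lt1|sum_ge1] := ltP (\sum_i r i) 1.
  by move: lt_dim;
    rewrite ltNge (thin_scaling_exponent0_ge (ltnW hN) SK hU sum_lt1).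
apply: (interior_locally_flat SK sum1).
have UK : U `<=` K by apply: sum_ratio_eq1 SK hU _; apply/le_anti; rewrite sum1.
have [oU [x Ux] _ _ _] := hU; exists x; apply: (interiorS UK).
by move/interior_id : oU => ->.
Qed.
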